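(* Let $\mathfrak{X}_m=(X_1,\dots,X_m)$ be a random $\mathbb{Z}_n$-sequence, i.e. the $X_i$ are independent and uniformly distributed on $\mathbb{Z}_n$, and suppose $\omega(n)$ is a function that satisfies $\omega(n)\to\infty$ as $n\to\infty$. (1) The following hold with high probability (as $n\to\infty$): $\mathfrak{X}_m$ is a Davenport Z-sequence if $m\ge\log_2 n+\omega(n)$; and $\mathfrak{X}_m$ is not a Davenport Z-sequence if $m\le\log_2 n-\omega(n)$. (2) Let $A=\{-1,1\}$. The following hold with high probability (as $n\to\infty$): $\mathfrak{X}_m$ is an $A$-weighted Davenport Z-sequence if $m\ge\log_3 n+\omega(n)$; and $\mathfrak{X}_m$ is not an $A$-weighted Davenport Z-sequence if $m\le\log_3 n-\omega(n)$. (3) Suppose $n=p_1\cdots p_r$ where the $p_i$ are distinct odd primes, and let $A=\mathbb{Z}_n^*$. If $m\ge\omega(n)$, then $\mathfrak{X}_m$ is an $A$-weighted Davenport Z-sequence with high probability (as $n\to\infty$).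
   Context: $\mathbb{Z}_n$ is the ring of integers modulo $n$ and $\mathbb{Z}_n^*$ its group of units. For $A\subseteq\mathbb{Z}_n\setminus\{0\}$, a sequence $\mathbf{x}=(x_1,\dots,x_m)\in(\mathbb{Z}_n)^m$ is an $A$-weighted Davenport Z-sequence if there exists $\mathbf{a}=(a_1,\dots,a_m)\in(A\cup\{0\})^m$, not all $a_i$ equal to $0$, such that $\sum_{i=1}^m a_ix_i=0$ in $\mathbb{Z}_n$. It is a Davenport Z-sequence if this holds with $A=\{1\}$, i.e. if there is a non-empty $I\subseteq\{1,\dots,m\}$ with $\sum_{i\in I}x_i=0$. Here $m$ is a positive integer that may depend on $n$. ''With high probability (as $n\to\infty$)'' means with probability approaching $1$ as $n\to\infty$: for every $\varepsilon>0$ there is $n_0$ (depending on $\varepsilon$ and the function $\omega$) such that for all $n\ge n_0$ (in part (3), all such $n$ that are products of distinct odd primes) and all positive integers $m$ satisfying the stated inequality, the stated event has probability at least $1-\varepsilon$. *)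

(* Defs.v *)
From HB Require Import structures.
From mathcomp Require Import all_boot all_order all_algebra.
From mathcomp Require Import all_classical all_reals all_analysis.

Set Implicit Arguments.
Unset Strict Implicit.
Unset Printing Implicit Defensive.

Import Order.TTheory GRing.Theory Num.Theory.
Import numFieldNormedType.Exports.

Local Open Scope classical_set_scope.
Local Open Scope ring_scope.

Definition weighted_davenport_Zseq (n m : nat) (A : {set 'Z_n})
    (x : 'I_m -> 'Z_n) : Prop :=
  exists a : 'I_m -> 'Z_n,
    [/\ forall i, a i \in (0 |: A)%SET,
        exists i, a i != 0
      & \sum_(i < m) a i * x i = 0].

Definition davenport_Zseq (n m : nat) (x : 'I_m -> 'Z_n) : Prop :=
  weighted_davenport_Zseq [set 1]%SET x.

Lemma davenport_ZseqP (n m : nat) (x : 'I_m -> 'Z_n) :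
  davenport_Zseq x <->
  exists2 I : {set 'I_m}, I != finset.set0 & \sum_(i in I) x i = 0.
Proof.
split=> [[a [aA [i0 ai0] sum0]]|[I /set0Pn[i0 i0I] sum0]].
  exists [set i | a i != 0]%SET; first by apply/set0Pn; exists i0; rewrite inE.
  rewrite -[RHS]sum0 big_mkcond; apply: eq_bigr => i _; rewrite inE.
  by have := aA i; rewrite !inE => /orP[] /eqP ->;
    rewrite ?eqxx ?oner_eq0 /= ?mul0r ?mul1r.
exists (fun i => (i \in I)%:R); split => [i||].
- by rewrite !inE; case: (i \in I); rewrite eqxx ?orbT.
- by exists i0; rewrite i0I oner_eq0.
- rewrite -[RHS]sum0 [RHS]big_mkcond; apply: eq_bigr => i _.
  by case: (i \in I); rewrite ?mul1r ?mul0r.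
Qed.

(* 'Z_n carries the discrete sigma-algebra, so measurability of [X i] is
   tested on singletons and independence on arbitrary subsets of 'Z_n. *)
Definition random_Zseq (R : realType) (d : measure_display)
    (T : measurableType d) (P : probability T R) (n m : nat)
    (X : 'I_m -> T -> 'Z_n) : Prop :=
  [/\ forall i z, measurable (X i @^-1` [set z]),
      forall i z, P (X i @^-1` [set z]) = (n%:R^-1)%:E
    & forall (J : {set 'I_m}) (B : 'I_m -> set 'Z_n),
        P (\bigcap_(i in [set` J]) X i @^-1` B i) =
        (\prod_(i in J) P (X i @^-1` B i))%E].

(* [C n m] is the range of the pairs (n, m) under consideration; the threshold
   [n0] is uniform in [m] and in the probability space carrying the sequence.
   The restriction [1 < n] is there because 'Z_0 and 'Z_1 denote Z/2. *)
Definition whp (R : realType) (C : nat -> nat -> Prop)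
    (Q : forall n m : nat, ('I_m -> 'Z_n) -> Prop) : Prop :=
  forall eps : R, 0 < eps -> exists n0 : nat, forall n m : nat,
    (n0 <= n)%N -> (1 < n)%N -> (0 < m)%N -> C n m ->
    forall (d : measure_display) (T : measurableType d)
      (P : probability T R) (X : 'I_m -> T -> 'Z_n),
    random_Zseq P X ->
    ((1 - eps)%:E <= P [set t | Q n m (fun i => X i t)])%E.

Definition logb (R : realType) (b x : R) : R := ln x / ln b.

Definition prod_distinct_odd_primes (n : nat) : Prop :=
  exists s : seq nat,
    [/\ uniq s, forall p, p \in s -> prime p && odd p
      & n = (\prod_(p <- s) p)%N].

(* Main.v *)
Require Import Defs.
From HB Require Import structures.
From mathcomp Require Import all_boot all_order all_algebra.
From mathcomp Require Import all_classical all_reals all_analysis.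
From mathcomp Require Import ring lra zify.

Set Implicit Arguments.
Unset Strict Implicit.
Unset Printing Implicit Defensive.

Import Order.TTheory GRing.Theory Num.Theory.
Import numFieldNormedType.Exports.

(* A sequence X is uniform on (Z_n)^m, so everything is a count of x in (Z_n)^m.
   For A contained in {1, -1} and q = |A| + 1 there are q^m - 1 nonzero weight
   vectors a, and each form a.x vanishes with probability 1/n.  Below the
   threshold the union bound suffices.  Above it, use the second moment: for
   weight vectors a, b with different supports, a.x and b.x vanish together with
   probability 1/n^2; for equal supports and b <> a, -a this is at most 2/n^2,
   and there are only |A|^m such b for each a, negligible against q^m.
   For n a product of distinct odd primes and units as weights, a relation whose
   coefficients are all units exists as soon as no prime p dividing n leaves
   exactly one x_i nonzero mod p (solve mod p, then glue by the Chinese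
   remainder theorem); the exceptional set has measure at most
   sum_p m / p^(m-1), which is O(m / 3^m) uniformly in n. *)

Local Open Scope ring_scope.

(* Provides the missing [finZmodType] instance on {ffun I -> V}. *)
HB.saturate finfun_of.

(** * Counting zeros of linear forms *)

(* [sigma] gives #|K| translates of the kernel that are pairwise disjoint. *)
Lemma card_kernel_le (G : finZmodType) (H : zmodType) (K : finType)
    (phi : G -> H) (sigma : K -> G) :
  {morph phi : x y / x + y} -> injective (phi \o sigma) ->
  (#|[set x | phi x == 0%R]| * #|K| <= #|G|)%N.
Proof.
move=> phiD inj_ps; rewrite -[#|K|]cardsT -cardsX.
apply: (@leq_card_in _ _ (fun u => u.1 + sigma u.2)) => -[x k] [y l].
rewrite !inE !andbT /= => /eqP x0 /eqP y0 e.
have kl : k = l by apply: inj_ps; have := congr1 phi e; rewrite !phiD x0 y0 !add0r.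
by move: e; rewrite kl => /addIr ->.
Qed.

(** The section [sigma] need not be additive. For the inequality missing from [card_kernel_le],
    subtracting [sigma (phi g)] from [g] lands in the kernel, and [g] is recovered from that
    difference and [phi g]. *)
Lemma card_kernel (G H : finZmodType) (phi : G -> H) (sigma : H -> G) :
  {morph phi : x y / x + y} -> cancel sigma phi ->
  (#|[set x | phi x == 0%R]| * #|H|)%N = #|G|.
Proof.
move=> phiD sigmaK; apply/eqP; rewrite eqn_leq (card_kernel_le phiD (sigma := sigma)) /=; last first.
  by move=> x y /=; rewrite !sigmaK.
rewrite -[#|G|]cardsT -[#|H|]cardsT -cardsX.
have inj : injective (fun g => (g - sigma (phi g), phi g)).
  by move=> x y [+ e]; rewrite e => /addIr.
rewrite -(card_imset _ inj); apply/subset_leq_card/fintype.subsetP => u /imsetP[g _ ->].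
have phi0 : phi 0 = 0 by apply: (@addIr _ (phi 0)); rewrite -phiD !add0r.
rewrite !inE /= andbT; apply/eqP/(@addIr _ (phi g)).
by rewrite -{2}(sigmaK (phi g)) -phiD subrK add0r.
Qed.

Section LinearForms.
Variables (R : finComUnitRingType) (m : nat).
Implicit Types (a b x : {ffun 'I_m -> R}) (i j : 'I_m) (s t : R).

Definition lin a x : R := \sum_(i < m) a i * x i.

Lemma linD a : {morph lin a : x y / x + y}.
Proof.
by move=> x y; rewrite -big_split; apply: eq_bigr => i _; rewrite ffunE mulrDr.
Qed.

Definition axis i s : {ffun 'I_m -> R} := [ffun j => if j == i then s else 0].

Lemma lin_axis a i s : lin a (axis i s) = a i * s.
Proof.
rewrite /lin (bigD1 i) //= ffunE eqxx big1 ?addr0 // => j /negPf ji.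
by rewrite ffunE ji mulr0.
Qed.

(** A single unit coefficient makes the form surjective, with a section along the axis [i]. *)
Lemma card_lin0 a i : a i \is a GRing.unit ->
  (#|[set x | lin a x == 0%R]| * #|R|)%N = (#|R| ^ m)%N.
Proof.
move=> ai; rewrite (card_kernel (sigma := fun s => axis i ((a i)^-1 * s)) (linD a)).
  by rewrite card_ffun card_ord.
by move=> s; rewrite lin_axis mulVKr.
Qed.

Definition lin2_zeros a b := [set x | (lin a x == 0) && (lin b x == 0)].

Lemma lin2_zerosC a b : lin2_zeros a b = lin2_zeros b a.
Proof. by apply/setP=> x; rewrite !inE andbC. Qed.

Lemma card_lin2_zeros_le (K : finType) (sigma : K -> {ffun 'I_m -> R}) a b :
  injective (fun k => (lin a (sigma k), lin b (sigma k))) ->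
  (#|lin2_zeros a b| * #|K| <= #|R| ^ m)%N.
Proof.
move=> inj; have := @card_kernel_le _ _ _ (fun x => (lin a x, lin b x)) sigma.
rewrite card_ffun card_ord; apply=> // x y; by rewrite !linD.
Qed.

(** Restricted to the axes [i] and [j] the pair of forms is triangular: [lin b] determines the
    coordinate on [j], then [lin a] the one on [i]. *)
Lemma card_lin2_zeros a b i j :
  a i \is a GRing.unit -> b i = 0 -> b j \is a GRing.unit ->
  (#|lin2_zeros a b| * #|R| ^ 2 <= #|R| ^ m)%N.
Proof.
move=> ai bi bj; rewrite -[(_ ^ 2)%N]card_prod.
apply: (card_lin2_zeros_le (sigma := fun st => axis i st.1 + axis j st.2)).
move=> [s t] [s' t']; rewrite !linD !lin_axis bi !mul0r !add0r /= => -[+ /(mulrI bj) tt].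
by rewrite tt => /addIr /(mulrI ai) ->.
Qed.

End LinearForms.

Lemma card_Zn n : (1 < n)%N -> #|'Z_n| = n.
Proof. by move=> n1; rewrite card_ord Zp_cast. Qed.

Lemma natrZ_eq n (k l : nat) : (1 < n)%N ->
  ((k%:R : 'Z_n) == l%:R) = (k == l %[mod n]).
Proof. by move=> n1; rewrite -val_eqE /= !val_Zp_nat. Qed.

(* On the span of the axes i and j the two forms are u s + v t and u s - v t,
   which determine s and 2 t; the factor 2 is needed when n is even. *)
Lemma card_lin2_zeros_signs n m (a b : {ffun 'I_m -> 'Z_n}) i j : (1 < n)%N ->
  a i \is a GRing.unit -> b i = a i -> a j \is a GRing.unit -> b j = - a j ->
  (#|lin2_zeros a b| * n ^ 2 <= 2 * n ^ m)%N.
Proof.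
move=> n1 ai bi aj bj.
(* Restricting t to about half of the residues keeps 2 t from wrapping around, so it determines t
   even when 2 is not a unit. *)
have dbl (k : 'I_(uphalf n)) : (k.*2 < n)%N.
  by case: k => k /=; rewrite uphalf_half -[X in (_ < X)%N]odd_double_half; lia.
have inj : injective (fun st : 'Z_n * 'I_(uphalf n) =>
    let x := axis i st.1 + axis j (st.2 : nat)%:R in (lin a x, lin b x)).
  move=> [s t] [s' t']; rewrite /= !linD !lin_axis bi bj => e.
  have {e} [/= e1 /= e2] := (congr1 fst e, congr1 snd e).
  have : a j * (t.*2)%:R = a j * (t'.*2)%:R.
    have := congr2 (fun u v => u - v) e1 e2.
    rewrite -!addnn !natrD !mulrDr !mulNr !opprD !opprK.
    by rewrite !(addrACA _ _ (- _)) !subrr !add0r.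
  move/(mulrI aj)/eqP; rewrite natrZ_eq // !modn_small // => /eqP/double_inj/val_inj tt.
  by move: e1; rewrite tt => /addIr /(mulrI ai) ->.
have := card_lin2_zeros_le inj; rewrite card_prod !card_Zn // card_ord => h.
have n2 : (n <= 2 * uphalf n)%N by rewrite uphalf_half -{1}(odd_double_half n); lia.
apply: leq_trans (leq_mul (leqnn 2) h).
by rewrite -mulnn [leqRHS]mulnCA leq_mul // [leqRHS]mulnCA leq_mul.
Qed.

(* Chebyshev's inequality for [N] under the uniform distribution on [T]:
   the mean of [N] is [F / n] and its variance at most [F * c / n ^ 2]. *)
Lemma card_zeros_le (T : finType) (N : T -> nat) (F n c : nat) :
  ((\sum_x N x) * n = F * #|T|)%N ->
  ((\sum_x N x ^ 2) * n ^ 2 <= F * (F + c) * #|T|)%N ->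
  (#|[set x | N x == 0%N]| * F <= c * #|T|)%N.
Proof.
move=> e1 e2; case: (posnP F) => [->|F0]; first by rewrite muln0.
(* Deviations are scaled by [n] to stay in the integers; each zero of [N] contributes exactly F^2 to
   the sum of squares. *)
have lb : (#|[set x | N x == 0%N]| * F ^ 2)%:Z <=
    \sum_x (n%:Z * (N x)%:Z - F%:Z) ^+ 2.
  rewrite (bigID (fun x => N x == 0%N)) /= ler_wpDr ?sumr_ge0 // => [x _|].
    exact: sqr_ge0.
  rewrite (eq_bigr (fun=> (F ^ 2)%N%:Z)) => [|x /eqP ->].
    by rewrite sumr_const cardsE -mulr_natl natz.
  by rewrite mulr0 sub0r sqrrN -rmorphXn.
have sq : \sum_x (n%:Z * (N x)%:Z - F%:Z) ^+ 2 =
    ((\sum_x N x ^ 2) * n ^ 2)%:Z - 2 * F%:Z * ((\sum_x N x) * n)%:Z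
    + (F ^ 2 * #|T|)%:Z.
  rewrite (eq_bigr (fun x => n%:Z ^+ 2 * (N x ^ 2)%N%:Z
      - 2 * n%:Z * F%:Z * (N x)%:Z + F%:Z ^+ 2)) => [|x _]; last by lia.
  rewrite !big_split /= sumr_const sumrN -!mulr_sumr -!rmorph_sum /=.
  set A := (\sum_x _)%N; set B := (\sum_x _)%N; rewrite -mulr_natr.
  rewrite (_ : #|(fun=> true) : {pred T}| = #|T|) // natz.
  by lia.
have h : (#|[set x | N x == 0%N]| * F * F <= c * #|T| * F)%N.
  move: lb; rewrite sq e1; nia.
by move: h; rewrite leq_pmul2r.
Qed.

(** * Moments of the number of vanishing combinations with weights 1, -1 *)

Section SignWeights.
Variables (n m : nat) (A : {set 'Z_n}).
Hypotheses (n_gt1 : (1 < n)%N) (A_sign : A \subset [set -1; 1]%SET).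
Implicit Types a b x : {ffun 'I_m -> 'Z_n}.

Definition weights : {set {ffun 'I_m -> 'Z_n}} :=
  [set a in ffun_on (0 |: A)%SET | a != 0]%SET.

Lemma weightsP a :
  reflect ((forall i, a i \in (0 |: A)%SET) /\ exists i, a i != 0) (a \in weights).
Proof.
rewrite !inE; apply: (iffP andP) => -[/ffun_onP aA an0]; split=> //.
  by apply/existsP; apply: contraNT an0 => /existsPn a0;
    apply/eqP/ffunP => i; rewrite ffunE; apply/eqP/negPn.
by case: an0 => i; apply: contraNneq => ->; rewrite ffunE.
Qed.

Lemma weighted_davenport_ZseqE x : weighted_davenport_Zseq A x <->
  exists2 a, a \in weights & lin a x = 0.
Proof.
split=> [[a [aA [i ai] sum0]]|[a /weightsP[aA an0] sum0]]; last by exists a.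
exists [ffun i => a i].
  by apply/weightsP; split=> [j|]; [|exists i]; rewrite ffunE.
by rewrite -[RHS]sum0; apply: eq_bigr => j _; rewrite ffunE.
Qed.

Lemma weights_sign a i : a \in weights -> a i != 0 -> a i = 1 \/ a i = -1.
Proof.
move=> /weightsP[/(_ i) + _] ai; rewrite in_setU1 (negPf ai) /=.
by move=> /(fintype.subsetP A_sign); rewrite !inE => /orP[] /eqP; auto.
Qed.

Lemma weights_unit a i : a \in weights -> a i != 0 -> a i \is a GRing.unit.
Proof. by move=> aW /(weights_sign aW)[]->; rewrite ?unitrN unitr1. Qed.

Lemma card_weights : 0 \notin A -> #|weights| = (#|A|.+1 ^ m).-1.
Proof.
move=> A0; have := cardsD1 0 [set a : {ffun 'I_m -> 'Z_n} in ffun_on (0 |: A)%SET].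
rewrite [in LHS]cardsE card_ffun_on card_ord cardsU1 A0 add1n => ->.
have -> : 0 \in [set a : {ffun 'I_m -> 'Z_n} in ffun_on (0 |: A)%SET].
  by rewrite inE; apply/ffun_onP => i; rewrite ffunE !inE eqxx.
by apply: eq_card => a; rewrite !inE andbC.
Qed.

Definition same_support a b := [forall i, (a i == 0) == (b i == 0)].

(** Off the support of [a] the entry of [b] must be 0; on it there are at most |A| choices. *)
Lemma card_same_support a : (0 < #|A|)%N ->
  (#|[set b in weights | same_support a b]| <= #|A| ^ m)%N.
Proof.
move=> A0; pose B i := if a i == 0 then [set 0%R]%SET else A.
have /subset_leq_card/leq_trans: [set b in weights | same_support a b]
    \subset family B.
  apply/fintype.subsetP => b; rewrite inE => /andP[/weightsP[bA _] /forallP ss].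
  apply/familyP => i; rewrite /B; have /eqP -> := ss i.
  have [->|bi] := eqVneq (b i) 0; first by rewrite inE.
  by have := bA i; rewrite in_setU1 (negPf bi).
apply; rewrite card_family foldrE big_map big_enum /=.
rewrite -[m in leqRHS]card_ord -prod_nat_const.
by apply: leq_prod => i _; rewrite /B; case: ifP => // _; rewrite cards1.
Qed.

Lemma card_lin0_weight a : a \in weights ->
  (#|[set x | lin a x == 0%R]| * n)%N = (n ^ m)%N.
Proof.
move=> aW; have /weightsP[_ [i ai]] := aW.
by have := card_lin0 (weights_unit aW ai); rewrite card_Zn.
Qed.

(** The indicators merge the cases into one summable bound: factor n for b = a or b = -a, where one
    form is redundant; otherwise 2 for equal supports and 1 for different supports. *)
Lemma card_lin2_zeros_weights a b : a \in weights -> b \in weights ->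
  (#|lin2_zeros a b| * n ^ 2 <=
   n ^ m * (1 + n * (b == a) + n * (b == - a) + same_support a b))%N.
Proof.
move=> aW bW.
have le1 : (#|lin2_zeros a b| * n ^ 2 <= n ^ m * n)%N.
  rewrite -(card_lin0_weight aW) -mulnA mulnn leq_mul2r subset_leq_card ?orbT //.
  by apply/fintype.subsetP => x; rewrite !inE => /andP[].
have [_|ba] := eqVneq b a; first by rewrite (leq_trans le1) // leq_mul2l; lia.
have [_|bNa] := eqVneq b (- a); first by rewrite (leq_trans le1) // leq_mul2l; lia.
have /weightsP[_ [i0 ai0]] := aW; have /weightsP[_ [j0 bj0]] := bW.
rewrite !muln0 !addn0 mulnDr muln1; have [ss|] := boolP (same_support a b).
  (* Entries are 0, 1 or -1, so with equal supports b <> a gives an index where b is -a, and b <> -a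
     one where b is a, both inside the support. *)
  have /existsP[i ai] : [exists i, b i != a i].
    by apply: contraNT ba => /existsPn h; apply/eqP/ffunP => i; apply/eqP/negPn.
  have /existsP[j aj] : [exists j, b j != - a j].
    apply: contraNT bNa => /existsPn h; apply/eqP/ffunP => k; rewrite ffunE.
    exact/eqP/negPn.
  have nz k : (a k == 0) = (b k == 0) by move/forallP: ss => /(_ k)/eqP.
  have ai' : a i != 0.
    by apply: contra ai => a0; have := a0; rewrite nz => /eqP ->; rewrite eq_sym.
  have aj' : a j != 0.
    by apply: contra aj => a0; have := a0; rewrite nz => /eqP ->; rewrite (eqP a0) oppr0.
  have bi' := ai'; rewrite nz in bi'; have bj' := aj'; rewrite nz in bj'.
  rewrite muln1 addnn -mul2n.
  apply: (@card_lin2_zeros_signs n m a b j i) => //; try exact: weights_unit.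
    by move: aj; case: (weights_sign aW aj') (weights_sign bW bj') => -> [] ->;
      rewrite ?opprK ?eqxx.
  by move: ai; case: (weights_sign aW ai') (weights_sign bW bi') => -> [] ->;
      rewrite ?opprK ?eqxx.
(* An index in exactly one of the supports makes the pair triangular, after exchanging [a] and [b]
   if necessary. *)
rewrite muln0 addn0 => /forallPn[i].
have := @card_lin2_zeros 'Z_n m; rewrite card_Zn // => le.
have [ai|ai] := eqVneq (a i) 0; have [bi|bi] //= := eqVneq (b i) 0 => _.
  by rewrite lin2_zerosC; apply: (le _ _ i i0) => //; apply: weights_unit.
by apply: (le _ _ i j0) => //; apply: weights_unit.
Qed.

Definition zero_weights x := [set a in weights | lin a x == 0%R].

Lemma sum_zero_weights :
  ((\sum_x #|zero_weights x|) * n = #|weights| * n ^ m)%N.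
Proof.
under eq_bigr => x _ do rewrite -sum1dep_card.
rewrite (exchange_big_dep (mem weights)) /= => [|x a _ /andP[]//].
rewrite big_distrl /= -sum_nat_const; apply: eq_bigr => a aW.
by rewrite sum1dep_card -[RHS](card_lin0_weight aW); congr (_ * _)%N;
  apply: eq_card => x; move: aW; rewrite !inE => ->.
Qed.

(** The square counts pairs (a, b) of weights vanishing at x. For fixed [a], summing the case bound
    over [b] gives |weights| from the 1's, at most n from each of b = a and b = -a, and at most
    |A|^m from equal supports. *)
Lemma sum_zero_weights2 : (0 < #|A|)%N ->
  ((\sum_x #|zero_weights x| ^ 2) * n ^ 2 <=
   #|weights| * (#|weights| + (2 * n + #|A| ^ m)) * n ^ m)%N.
Proof.
move=> A0; have -> : (\sum_x #|zero_weights x| ^ 2 =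
    \sum_(a in weights) \sum_(b in weights) #|lin2_zeros a b|)%N.
  pose z a x := (lin a x == 0) : nat.
  have zE x : #|zero_weights x| = (\sum_(a in weights) z a x)%N.
    by rewrite -sum1dep_card big_mkcondr.
  under eq_bigr => x _ do rewrite zE -mulnn big_distrlr /=.
  rewrite exchange_big; apply: eq_bigr => a _; rewrite exchange_big.
  apply: eq_bigr => b _; rewrite -sum1dep_card [RHS]big_mkcond; apply: eq_bigr => x _.
  by rewrite /z; do 2 case: (_ == 0).
rewrite big_distrl /= -mulnA -sum_nat_const; apply: leq_sum => a aW.
rewrite big_distrl /=; apply: leq_trans (_ : \sum_(b in weights)
   n ^ m * (1 + n * (b == a) + n * (b == - a) + same_support a b) <= _)%N.
  by apply: leq_sum => b bW; apply: card_lin2_zeros_weights.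
rewrite -big_distrr /= mulnC leq_mul2r; apply/orP; right.
rewrite mul2n -addnn -[(n + n + _)%N]addnA !big_split /= sum1_card -!addnA leq_add2l.
have pt c : (\sum_(b in weights) n * (b == c) <= n)%N.
  rewrite -big_distrr /= -[leqRHS]muln1 leq_mul2l -big_mkcondr /= sum1dep_card.
  apply/orP; right; rewrite -(cards1 c); apply: subset_leq_card.
  by apply/fintype.subsetP => b; rewrite [in X in X -> _]inE => /andP[_ /eqP ->]; rewrite inE.
rewrite !leq_add ?pt //; apply: leq_trans (card_same_support a A0).
by rewrite -sum1dep_card big_mkcondr.
Qed.

(** This is the union bound: the number of bad x is at most the first moment. *)
Lemma card_Zseq :
  (#|[set x | zero_weights x != finset.set0]%SET| * n <= #|A|.+1 ^ m * n ^ m)%N.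
Proof.
rewrite (leq_trans (n := (\sum_x #|zero_weights x|) * n)) ?leq_mul2r //.
  rewrite -sum1dep_card big_mkcond leq_sum ?orbT // => x _.
  by case: ifP => //; rewrite card_gt0.
rewrite sum_zero_weights leq_mul2r; apply/orP; right.
rewrite (@leq_trans (#|(0 |: A)%SET| ^ m)) //.
  rewrite -[m in leqRHS]card_ord -card_ffun_on; apply: subset_leq_card.
  by apply/fintype.subsetP => a; rewrite inE => /andP[].
by rewrite cardsU1; case: (m) => // k; rewrite leq_exp2r // -[leqRHS]add1n leq_add2r leq_b1.
Qed.

(** Chebyshev's bound [card_zeros_le] with F = |weights| and c = 2 n + |A|^m. *)
Lemma card_not_Zseq : 0 \notin A -> (0 < #|A|)%N ->
  (#|[set x | zero_weights x == finset.set0]%SET| * (#|A|.+1 ^ m).-1 <=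
   (2 * n + #|A| ^ m) * n ^ m)%N.
Proof.
move=> A0 A_gt0; rewrite -(card_weights A0).
have cT : #|{ffun 'I_m -> 'Z_n}| = (n ^ m)%N by rewrite card_ffun card_Zn // card_ord.
have := @card_zeros_le {ffun 'I_m -> 'Z_n} (fun x => #|zero_weights x|) #|weights| n
  (2 * n + #|A| ^ m); rewrite cT => /(_ sum_zero_weights (sum_zero_weights2 A_gt0)).
by congr (_ * _ <= _)%N; apply: eq_card => x; rewrite !inE cards_eq0.
Qed.

End SignWeights.

(** * From counting to probability *)

Local Open Scope classical_set_scope.

(** The event is a finite disjoint union of the events [E x] that X takes the value x; independence
    over the full index set gives each of them probability n^-m. In particular the event is
    measurable for every [Q]. *)
Lemma random_Zseq_prob (R : realType) (d : measure_display)
    (T : measurableType d) (P : probability T R) (n m : nat)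
    (X : 'I_m -> T -> 'Z_n) (Q : ('I_m -> 'Z_n) -> Prop) :
  random_Zseq P X ->
  P [set t | Q (X^~ t)] =
  (#|[set x : {ffun 'I_m -> 'Z_n} | `[< Q x >]]%SET|%:R / (n ^ m)%:R)%:E.
Proof.
move=> [mX uX iX]; set S := [set x | _]%SET.
pose E (x : {ffun 'I_m -> 'Z_n}) := \bigcap_(i in [set` [set: 'I_m]%SET]) X i @^-1` [set x i].
have EP x t : E x t <-> x = [ffun i => X i t].
  split=> [Ex|-> i _]; last by rewrite /= ffunE.
  by apply/ffunP => i; rewrite ffunE -(Ex i) //= inE.
have PE x : P (E x) = ((n ^ m)%:R^-1)%:E.
  rewrite /E iX; under eq_bigr => i _ do rewrite uX.
  by rewrite prodEFin prodr_const cardsT card_ord natrX exprVn.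
have mE x : measurable (E x).
  by apply: fin_bigcap_measurable => // i _; apply: mX.
have -> : [set t | Q (X^~ t)] = \bigcup_(x in [set` S]) E x.
  apply/seteqP; split=> t /= => [QX|[x]].
    exists [ffun i => X i t]; last exact/EP.
    by rewrite /= inE; apply/asboolP; congr (Q _) : QX; apply/funext => i; rewrite ffunE.
  by rewrite /= inE => /asboolP + /EP xE; rewrite xE; congr (Q _); apply/funext => i; rewrite ffunE.
rewrite measure_fin_bigcup //; last first.
  apply/trivIsetP => x y _ _ xy; apply/seteqP; split=> t //= -[/EP xE /EP yE].
  by rewrite xE yE eqxx in xy.
have -> : [set` S] = [set` enum S] by apply/seteqP; split=> x /=; rewrite mem_enum.
rewrite -fsbig_seq ?enum_uniq // big_enum /=.
by under eq_bigr => x _ do rewrite PE; rewrite sumEFin sumr_const mulr_natl.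
Qed.

(** The proportion of bad sequences is at most 27 (2/3)^k, where k will be a lower bound for omega
    up to a constant. The rate 2/3 is slow enough to serve all the cases, and 27 = 3^3 absorbs the
    exponent m - 3 of the unit case. *)
Lemma whp_of_count (R : realType) (C : nat -> nat -> Prop)
    (Q : forall n m : nat, ('I_m -> 'Z_n) -> Prop) :
  (forall k, exists n0, forall n m, (n0 <= n)%N -> (1 < n)%N -> (0 < m)%N -> C n m ->
     (3 ^ k * #|[set x : {ffun 'I_m -> 'Z_n} | `[< ~ Q n m x >]]%SET|
      <= 27 * 2 ^ k * n ^ m)%N) ->
  whp R C Q.
Proof.
move=> count e e0.
have [k ke] : exists k, 27 * (2 / 3) ^+ k <= e.
  have : (27 * (2 / 3 : R) ^+ k) @[k --> \oo] --> 27 * (0 : R).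
    apply: cvgM; first exact: cvg_cst.
    by apply: cvg_expr; rewrite ger0_norm; lra.
  rewrite mulr0 => /cvgrPdist_le/(_ _ e0)[k _ /(_ k (leqnn k))].
  rewrite /= sub0r normrN ger0_norm => [?|]; first by exists k.
  by rewrite mulr_ge0 // exprn_ge0 //; lra.
have [n0 {}count] := count k; exists n0 => n m n0n n1 m0 Cnm d T P X rX.
have {}count := count n m n0n n1 m0 Cnm.
rewrite (random_Zseq_prob (Q n m) rX) lee_fin.
set B := (X in (_ * X <= _)%N) in count.
have nm0 : 0 < (n ^ m)%:R :> R by rewrite ltr0n expn_gt0 ltnW.
have -> : #|[set x : {ffun 'I_m -> 'Z_n} | `[< Q n m x >]]%SET| = (n ^ m - B)%N.
  have := cardsC [set x : {ffun 'I_m -> 'Z_n} | `[< Q n m x >]]%SET.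
  rewrite card_ffun card_Zn // card_ord => <-.
  rewrite -[LHS](addnK B); congr (_ + _ - _)%N.
  by apply: eq_card => x; rewrite !inE asbool_neg.
have Bnm : (B <= n ^ m)%N.
  by rewrite -[m in leqRHS]card_ord -[n in leqRHS](card_Zn n1) -card_ffun max_card.
rewrite ler_pdivlMr // natrB // mulrBl mul1r lerD2l lerN2.
have k3 : 0 < (3 : R) ^+ k by rewrite exprn_gt0.
rewrite (le_trans _ (ler_wpM2r (ltW nm0) ke)) // expr_div_n.
rewrite -(ler_pM2l k3); move: count; rewrite -(ler_nat R) !natrM !natrX => /le_trans; apply.
by rewrite le_eqVlt; apply/orP; left; apply/eqP; field; rewrite lt0r_neq0.
Qed.

Lemma omega_ge (R : realType) (omega : nat -> R) (k : nat) :
  omega n @[n --> \oo] --> +oo ->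
  exists n0, forall n, (n0 <= n)%N -> k%:R <= omega n.
Proof. by move=> /cvgryPge/(_ k%:R)[n0 _ h]; exists n0. Qed.

Lemma logb_add_le (R : realType) (q n m k : nat) : (1 < q)%N -> (0 < n)%N ->
  logb q%:R n%:R + k%:R <= m%:R :> R -> (n * q ^ k <= q ^ m)%N.
Proof.
move=> q1 n0; rewrite -lerBrDr; have lq : 0 < ln q%:R :> R by rewrite ln_gt0 // ltr1n.
rewrite /logb ler_pdivrMr // mulrBl !mulr_natl -!lnXn ?ltr0n ?(ltnW q1) //.
rewrite lerBrDr -lnM ?posrE ?exprn_gt0 ?ltr0n ?(ltnW q1) //.
by rewrite ler_ln ?posrE ?mulr_gt0 ?exprn_gt0 ?ltr0n ?(ltnW q1) // -!natrX -natrM ler_nat.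
Qed.

Lemma le_logb_sub (R : realType) (q n m k : nat) : (1 < q)%N -> (0 < n)%N ->
  m%:R <= logb q%:R n%:R - k%:R :> R -> (q ^ (m + k) <= n)%N.
Proof.
move=> q1 n0; rewrite lerBrDr -natrD; have lq : 0 < ln q%:R :> R by rewrite ln_gt0 // ltr1n.
rewrite /logb ler_pdivlMr // mulr_natl -lnXn ?ltr0n ?(ltnW q1) //.
by rewrite ler_ln ?posrE ?exprn_gt0 ?ltr0n ?(ltnW q1) // -natrX ler_nat.
Qed.

(** * Unit weights *)

(** Choose nonzero coefficients away from two nonzero entries [x i], [x j], leaving a partial sum t.
    It remains to split -t as a sum of two nonzero elements, which is possible once 2 is nonzero. *)
Lemma nonzero_coefs_zero_sum (F : fieldType) (m : nat) (x : 'I_m -> F) :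
  (2 : F) != 0 ->
  (forall i, x i != 0 -> exists2 j, j != i & x j != 0) ->
  exists a : 'I_m -> F, (forall i, a i != 0) /\ \sum_i a i * x i = 0.
Proof.
move=> F2 x2; case: (pickP (fun i => x i != 0)) => [i xi|x0]; last first.
  exists (fun=> 1); split=> [i|]; first by rewrite oner_neq0.
  by rewrite big1 // => i _; move/negbFE/eqP: (x0 i) => ->; rewrite mulr0.
have [j ji xj] := x2 i xi.
pose b k := if x k == 0 then 1 else (x k)^-1.
pose t := \sum_(k | (k != i) && (k != j)) b k * x k.
(* Both c and -t - c must be nonzero. The value 1 fails only for t = -1, and then c = -1 leaves -t -
   c = 2. *)
pose c : F := if t == -1 then -1 else 1.
exists (fun k => if k == i then c / x i else if k == j then (- t - c) / x j else b k).
split=> [k|].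
  have c0 : c != 0 by rewrite /c; case: ifP; rewrite ?oppr_eq0 oner_neq0.
  case: ifP => _; first by rewrite mulf_neq0 ?invr_neq0.
  case: ifP => _.
    rewrite mulf_neq0 ?invr_neq0 // /c; case: ifPn => [/eqP ->|tN1].
      by rewrite !opprK.
    by rewrite subr_eq0 -subr_eq0 -oppr_eq0 opprB opprK addrC -[1]opprK subr_eq0.
  by rewrite /b; have [_|/invr_neq0 //] := eqVneq (x k) 0; rewrite oner_neq0.
rewrite (bigD1 i) //= eqxx divfK // (bigD1 j) //= (negPf ji) eqxx divfK //.
rewrite (eq_bigr (fun k => b k * x k)) => [|k /andP[/negPf -> /negPf ->] //].
by rewrite -/t; ring.
Qed.

(** Induction on the primes: coefficients mod p come from the field case, those mod the remaining
    product from the induction hypothesis, and [chinese] glues them. Natural numbers are used so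
    that the modulus may change along the induction. *)
Lemma coprime_coefs_zero_sum (m : nat) (x : 'I_m -> nat) (s : seq nat) :
  uniq s -> (forall p, p \in s -> prime p && odd p) ->
  (forall p, p \in s -> forall i, ~~ (p %| x i)%N ->
     exists2 j, j != i & ~~ (p %| x j)%N) ->
  exists a : 'I_m -> nat, (forall i, coprime (\prod_(p <- s) p)%N (a i)) /\
    (\prod_(p <- s) p %| \sum_i a i * x i)%N.
Proof.
elim: s => [_ _ _|p s IHs /= /andP[ps us] primes_s x2].
  by exists (fun=> 1%N); rewrite big_nil; split=> [i|]; rewrite ?coprimen1 ?dvd1n.
have [|q qs|a [a_cop a_sum]] := IHs us; rewrite ?inE.
- by move=> q qs; apply: primes_s; rewrite inE qs orbT.
- by apply: x2; rewrite inE qs orbT.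
have /andP[p_pr p_odd] := primes_s p (mem_head _ _).
have pE k : (p %| k)%N = ((k%:R : 'F_p) == 0) by rewrite (dvdn_pcharf (pchar_Fp p_pr)).
have [||b [b0 b_sum]] := @nonzero_coefs_zero_sum 'F_p m (fun i => (x i)%:R).
- rewrite -pE; apply: contraL p_odd => p2.
  by move: p2; rewrite dvdn_prime2 // => /eqP ->.
- by move=> i; rewrite -pE => /(x2 p (mem_head _ _))[j ji xj]; exists j => //; rewrite -pE.
set N := (\prod_(q <- s) q)%N in a_cop a_sum *; rewrite big_cons -/N.
have pN : coprime p N.
  rewrite prime_coprime // Euclid_dvd_prod // big_has_cond; apply: contra ps.
  case/hasP => q qs /=.
  have /andP[q_pr _] : prime q && odd q by rewrite primes_s // inE qs orbT.
  by rewrite dvdn_prime2 // => /eqP ->.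
pose c i := chinese p N (b i) (a i); exists c; split=> [i|].
  rewrite coprimeMl -coprime_modr chinese_modl // coprime_modr.
  rewrite prime_coprime // pE natr_Zp b0 /=.
  by rewrite -coprime_modr chinese_modr // coprime_modr.
rewrite Gauss_dvd // pE natr_sum -[X in _ == X]b_sum; apply/andP; split.
  apply/eqP/eq_bigr => i _; rewrite natrM; congr (_ * _).
  by rewrite -[LHS]Fp_nat_mod // chinese_modl // Fp_nat_mod // natr_Zp.
rewrite /dvdn -modn_summ; under eq_bigr => i _ do rewrite -modnMml chinese_modr // modnMml.
by rewrite modn_summ.
Qed.

(** Since p divides n, reduction mod p is additive on ['Z_n]; the residues below p have distinct
    images. *)
Lemma card_dvd_Zn n p : (1 < n)%N -> prime p -> (p %| n)%N ->
  (#|[set z : 'Z_n | (p %| z)%N]%SET| * p <= n)%N.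
Proof.
move=> n1 p_pr pn; have p1 := prime_gt1 p_pr.
pose phi (z : 'Z_n) : 'F_p := (z : nat)%:R.
have phiE (k : nat) : phi k%:R = k%:R.
  by rewrite /phi val_Zp_nat // -[LHS]Fp_nat_mod // modn_dvdm // Fp_nat_mod.
have phiD : {morph phi : x y / x + y}.
  by move=> x y; rewrite -[x]natr_Zp -[y]natr_Zp -natrD !phiE natrD.
have inj : injective (phi \o (fun k : 'I_p => (k : nat)%:R)).
  move=> k l /= /(congr1 (@nat_of_ord _)); rewrite !phiE !val_Fp_nat // !modn_small //.
  exact: val_inj.
have := card_kernel_le phiD inj; rewrite card_Zn // card_ord.
congr (_ * _ <= _)%N; apply: eq_card => z.
by rewrite !inE (dvdn_pcharf (pchar_Fp p_pr)).
Qed.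

(** The set is a product: free at [i], of density at most 1/p in each of the other m - 1
    coordinates. *)
Lemma card_almost_dvd n m p (i : 'I_m) : (1 < n)%N -> prime p -> (p %| n)%N ->
  (#|[set x : {ffun 'I_m -> 'Z_n} | [forall (j | j != i), p %| x j]%N]%SET|
   * p ^ m.-1 <= n ^ m)%N.
Proof.
move=> n1 p_pr pn.
pose B j := if j == i then finset.setT else [set z : 'Z_n | (p %| z)%N]%SET.
have -> : #|[set x : {ffun 'I_m -> 'Z_n} | [forall (j | j != i), p %| x j]%N]%SET| =
    (\prod_j #|B j|)%N.
  transitivity #|(family B : simpl_pred {ffun 'I_m -> 'Z_n})|; last first.
    by rewrite card_family foldrE big_map big_enum.
  apply: eq_card => x; rewrite inE; apply/forallP/familyP => h j; have := h j.
    by rewrite /B; case: eqP => /= _; rewrite inE.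
  by rewrite /B; case: eqP => /= _; rewrite inE.
rewrite (bigD1 i) //= /B eqxx cardsT card_Zn // -mulnA.
have m0 : (0 < m)%N := leq_ltn_trans (leq0n i) (ltn_ord i).
have cC : #|[pred j : 'I_m | j != i]| = m.-1.
  by have := cardC1 i; rewrite card_ord.
rewrite -[in leqRHS](prednK m0) expnS leq_mul2l; apply/orP; right.
rewrite -cC -!prod_nat_const -big_split /=.
by apply: leq_prod => j /negPf ->; apply: card_dvd_Zn.
Qed.

Lemma card_no_unit_zero_sum n m : (2 < m)%N -> (1 < n)%N ->
  prod_distinct_odd_primes n ->
  (#|[set x : {ffun 'I_m -> 'Z_n} |
       `[< ~ weighted_davenport_Zseq [set a : 'Z_n | a \is a GRing.unit]%SET x >]]%SET|
   * 3 ^ (m - 3) <= m * n ^ m)%N.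
Proof.
move=> m2 n1 [s [us primes_s nE]]; set B := [set x | _]%SET.
have dvd_n p : p \in s -> (p %| n)%N by move=> ps; rewrite nE (big_rem p) //= dvdn_mulr.
pose D p i := [set x : {ffun 'I_m -> 'Z_n} | [forall (j | j != i), p %| x j]%N]%SET.
(* If x avoids every [D p i], then for each p no entry is the only one not divisible by p, so a
   relation with unit coefficients exists. *)
have cov x : x \in B -> exists2 p, p \in s & exists i, x \in D p i.
  rewrite inE => /asboolP nx; apply: contrapT => nD; apply: nx.
  have [|a [a_cop a_sum]] := @coprime_coefs_zero_sum m (fun i => x i) s us primes_s.
    move=> p ps i pxi; apply: contrapT => nj; apply: nD; exists p => //; exists i.
    rewrite inE; apply/'forall_implyP => j ji; apply: contrapT => /negP pxj.
    by apply: nj; exists j.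
  exists (fun i => (a i)%:R); have a_unit i : ((a i)%:R : 'Z_n) \is a GRing.unit.
    by rewrite unitZpE // nE.
  split=> [i||].
  - by rewrite !inE a_unit orbT.
  - exists (Ordinal (ltnW (ltnW m2))).
    by apply: contraTneq (a_unit (Ordinal (ltnW (ltnW m2)))) => ->; rewrite unitr0.
  under eq_bigr => i _ do rewrite -[x i]natr_Zp -natrM.
  rewrite -natr_sum; apply/eqP; rewrite -[X in _ == X](mulr0n 1) natrZ_eq // mod0n.
  by rewrite [X in (_ %% X)%N]nE.
(* The primes are indexed inside the interval from 2 to n, rather than by [s], so that the sum can
   later be compared with a telescoping one. *)
have cB : (#|B| <= \sum_(2 <= p < n.+1 | p \in s) \sum_(i < m) #|D p i|)%N.
  have -> : (\sum_(2 <= p < n.+1 | p \in s) \sum_(i < m) #|D p i| =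
     \sum_x \sum_(2 <= p < n.+1 | p \in s) \sum_(i < m) (x \in D p i))%N.
    rewrite [RHS]exchange_big; apply: eq_bigr => p _; rewrite [RHS]exchange_big.
    by apply: eq_bigr => i _; rewrite -sum1_card big_mkcond.
  rewrite -sum1_card big_mkcond; apply: leq_sum => x _; case: ifP => // /cov[p ps [i xD]].
  have /andP[p_pr _] := primes_s p ps.
  rewrite big_mkcond (bigD1_seq p) /=; last exact: iota_uniq.
    by rewrite ps (bigD1 i) //= xD -addnA leq_addr.
  by rewrite mem_index_iota prime_gt1 //= ltnS dvdn_leq ?dvd_n // ltnW.
rewrite -(ler_nat rat) !natrM.
have cD p i : p \in s -> (#|D p i| * 3 ^ (m - 3))%:R <=
    (n ^ m)%:R * ((p.-1)%:R^-1 - p%:R^-1) :> rat.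
  move=> ps; have /andP[p_pr p_odd] := primes_s p ps.
  have := card_almost_dvd i n1 p_pr (dvd_n p ps); rewrite -/(D p i).
  case: p p_pr p_odd {ps} => [|[|p]] // p_pr p_odd.
  have p3 := odd_prime_gt2 p_odd p_pr.
  have -> : m.-1 = (m - 3 + 2)%N by lia.
  rewrite expnD => le.
  have -> : (p.+1)%:R^-1 - p.+2%:R^-1 = ((p.+1 * p.+2)%N%:R)^-1 :> rat.
    have p0 := ler0n rat p; rewrite natrM -[p.+2]addn1 natrD.
    by field; apply/andP; split; apply: lt0r_neq0; lra.
  rewrite ler_pdivlMr ?ltr0n // -natrM ler_nat (leq_trans _ le) // -mulnA leq_mul2l.
  rewrite leq_mul ?orbT //; last by rewrite -mulnn leq_mul2r leqnSn orbT.
  by case: (m - 3)%N => // e; rewrite leq_exp2r.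
(* The bound n ^ m / p ^ (m - 1) on #|D p i| is summable over p by telescoping,
   since p ^ (m - 1) >= 3 ^ (m - 3) * p * (p - 1). *)
have cS : \sum_(2 <= p < n.+1 | p \in s) (p.-1%:R^-1 - p%:R^-1) <= 1 :> rat.
  rewrite big_mkcond /=.
  apply: (@le_trans _ _ (\sum_(2 <= p < n.+1) (p.-1%:R^-1 - p%:R^-1))).
    rewrite !big_nat; apply: ler_sum => p /andP[p2 _]; case: ifP => // _.
    rewrite subr_ge0 lef_pV2 ?posrE ?ltr0n ?ler_nat //; lia.
  rewrite (telescope_sumr_eq (fun p => - p.-1%:R^-1)) => [||p _]; first 1 last.
  - exact: ltnW.
  - by rewrite /= opprK addrC.
  by rewrite /= opprK invr1 gerDr oppr_le0 invr_ge0 ler0n.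
apply: (@le_trans _ _ ((\sum_(2 <= p < n.+1 | p \in s) \sum_(i < m) #|D p i|)%:R * (3 ^ (m - 3))%:R)).
  by rewrite ler_wpM2r ?ler0n // ler_nat.
rewrite -natrM big_distrl natr_sum /=.
apply: (@le_trans _ _ (\sum_(2 <= p < n.+1 | p \in s) (m%:R * (n ^ m)%:R) * (p.-1%:R^-1 - p%:R^-1))).
  apply: ler_sum => p ps; rewrite big_distrl natr_sum /=.
  rewrite -mulrA mulr_natl -[X in _ *+ X](card_ord m) -sumr_const.
  by apply: ler_sum => i _; apply: cD.
by rewrite -mulr_sumr ler_piMr // mulr_ge0 ?ler0n.
Qed.

(** * Thresholds *)

Lemma zero_weightsP n m (A : {set 'Z_n}) (x : {ffun 'I_m -> 'Z_n}) :
  weighted_davenport_Zseq A x <-> zero_weights A x != finset.set0.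
Proof.
rewrite weighted_davenport_ZseqE; split=> [[a aW ax]|/set0Pn[a]].
  by apply/set0Pn; exists a; rewrite inE aW ax eqxx.
by rewrite inE => /andP[aW /eqP ax]; exists a.
Qed.

(** Use a c <= b d in k of the m factors and c <= d in the remaining m - k. *)
Lemma leq_expM_exp a b c d k m : (a * c <= b * d)%N -> (c <= d)%N -> (k <= m)%N ->
  (a ^ k * c ^ m <= b ^ k * d ^ m)%N.
Proof.
have leX u v e : (u <= v)%N -> (u ^ e <= v ^ e)%N.
  by case: e => // e uv; rewrite leq_exp2r.
move=> acbd cd /subnK <-.
by rewrite !expnD ![(_ * (_ ^ (m - k) * _))%N]mulnCA -!expnMn leq_mul // leX.
Qed.

Section SignThreshold.
Variables (R : realType) (omega : nat -> R) (q : nat).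
Variable A : forall n, {set 'Z_n}.
Hypothesis omega_oo : omega n @[n --> \oo] --> +oo.
Hypothesis q23 : (1 < q <= 3)%N.
Hypothesis A_sign : forall n, A n \subset [set -1; 1]%SET.
Hypothesis A0 : forall n, 0 \notin A n.
Hypothesis card_A : forall n, (2 < n)%N -> #|A n| = q.-1.

(** Divided by q^m, the second-moment bound has the terms n / q^m <= q^-k and ((q - 1) / q)^m with m
    >= k. Both are at most (2/3)^k because q is 2 or 3. *)
Lemma whp_sign_Zseq : whp R (fun n m => logb q%:R n%:R + omega n <= m%:R)
  (fun n m x => weighted_davenport_Zseq (A n) x).
Proof.
have /andP[q1 q3] := q23.
apply: whp_of_count => k; have [n0 n0P] := omega_ge k omega_oo.
(* The bound n >= 3 excludes ['Z_2], where 1 = -1 and the two signs coincide. *)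
exists (maxn n0 3) => n m; rewrite geq_max => /andP[/n0P wk n2] n1 m0 Cnm.
have nq : (n * q ^ k <= q ^ m)%N.
  by apply: (@logb_add_le R) => //; [by rewrite ltnW|rewrite (le_trans _ Cnm) // lerD2l].
have km : (k <= m)%N.
  by rewrite -(leq_exp2l _ _ q1) (leq_trans _ nq) // leq_pmull // ltnW.
set B := [set x | _]%SET.
have : (#|B| * (q ^ m).-1 <= (2 * n + q.-1 ^ m) * n ^ m)%N.
  have := @card_not_Zseq n m (A n) n1 (A_sign n) (A0 n).
  rewrite card_A // prednK ?(ltnW q1) // => h; move: {h}(h ltac:(lia)).
  congr (_ * _ <= _)%N; apply: eq_card => x; rewrite !inE.
  by apply/eqP/asboolP; rewrite zero_weightsP; [move=> ->; rewrite eqxx|move/negP/negPn/eqP].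
have qm : (2 <= q ^ m)%N by rewrite (leq_trans _ (leq_pexp2l _ m0)) // ltnW.
have qk : (3 ^ k <= 2 ^ k * q ^ k)%N.
  by have := @leq_expM_exp 3 2 1 q k k; rewrite exp1n !muln1; apply=> //; lia.
have kn : (3 ^ k * n <= 2 ^ k * q ^ m)%N.
  by rewrite (leq_trans _ (leq_mul (leqnn _) nq)) // mulnC mulnCA leq_mul.
have kq : (3 ^ k * q.-1 ^ m <= 2 ^ k * q ^ m)%N by apply: leq_expM_exp; lia.
move=> h; rewrite -(leq_pmul2r (ltnW qm)).
move: (n ^ m)%N (q ^ m)%N (q.-1 ^ m)%N (3 ^ k)%N (2 ^ k)%N h qm kn kq => N W V u v h qm kn kq.
(* Replacing q^m - 1 by q^m costs a factor 2, so the final constant is 4 + 2 = 6, below 27. *)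
have W2 : (W <= 2 * W.-1)%N by lia.
apply: (@leq_trans (u * (2 * ((2 * n + V) * N)))).
  by rewrite -mulnA leq_mul // (leq_trans (leq_mul (leqnn _) W2)) // mulnCA leq_mul.
by rewrite [leqLHS](_ : _ = (4 * (u * n) + 2 * (u * V)) * N)%N; [nia|ring].
Qed.

(** The union bound gives proportion at most q^m / n <= q^-k, and 1/q <= 2/3. *)
Lemma whp_not_sign_Zseq : whp R (fun n m => m%:R <= logb q%:R n%:R - omega n)
  (fun n m x => ~ weighted_davenport_Zseq (A n) x).
Proof.
have /andP[q1 q3] := q23.
apply: whp_of_count => k; have [n0 n0P] := omega_ge k omega_oo.
exists (maxn n0 3) => n m; rewrite geq_max => /andP[/n0P wk n2] n1 m0 Cnm.
have qn : (q ^ (m + k) <= n)%N.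
  apply: (@le_logb_sub R) => //; first by rewrite ltnW.
  by rewrite (le_trans Cnm) // lerD2l lerN2.
set B := [set x | _]%SET.
have : (#|B| * n <= q ^ m * n ^ m)%N.
  have := @card_Zseq n m (A n) n1 (A_sign n).
  rewrite card_A // prednK ?(ltnW q1) //.
  congr (_ * _ <= _)%N; apply: eq_card => x; rewrite !inE.
  by apply/idP/asboolP => [/zero_weightsP Zx /(_ Zx)|/contrapT/zero_weightsP].
have qk : (3 ^ k <= 2 ^ k * q ^ k)%N.
  by have := @leq_expM_exp 3 2 1 q k k; rewrite exp1n !muln1; apply=> //; lia.
move=> h; have qm0 : (0 < q ^ m)%N by rewrite expn_gt0 ltnW.
have {}h : (#|B| * q ^ k <= n ^ m)%N.
  rewrite -(leq_pmul2l qm0) (leq_trans _ h) // mulnCA -expnD leq_mul //.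
rewrite (leq_trans (leq_mul qk (leqnn _))) // -mulnA [(q ^ k * _)%N]mulnC.
by rewrite leq_mul // leq_pmull.
Qed.

End SignThreshold.

Theorem theorem3 (R : realType) (omega : nat -> R)
    (homega : omega n @[n --> \oo] --> +oo) :
  (* (1) *)
  (whp R (fun n m => logb 2 n%:R + omega n <= m%:R)
     (fun n m x => davenport_Zseq x) /\
   whp R (fun n m => m%:R <= logb 2 n%:R - omega n)
     (fun n m x => ~ davenport_Zseq x)) /\
  (* (2) *)
  (whp R (fun n m => logb 3 n%:R + omega n <= m%:R)
     (fun n m x => weighted_davenport_Zseq [set -1; 1]%SET x) /\
   whp R (fun n m => m%:R <= logb 3 n%:R - omega n)
     (fun n m x => ~ weighted_davenport_Zseq [set -1; 1]%SET x)) /\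
  (* (3) *)
  whp R (fun n m => prod_distinct_odd_primes n /\ omega n <= m%:R)
    (fun n m x => weighted_davenport_Zseq
       [set a : 'Z_n | a \is a GRing.unit]%SET x).
Proof.
have A1 n : [set 1 : 'Z_n]%SET \subset [set -1; 1]%SET by rewrite finset.sub1set !inE eqxx orbT.
have A1_0 n : 0 \notin [set 1 : 'Z_n]%SET by rewrite inE eq_sym oner_eq0.
have A2_0 n : 0 \notin [set -1; 1 : 'Z_n]%SET.
  by rewrite !inE ![0 == _]eq_sym oppr_eq0 oner_eq0.
have cA1 n : (2 < n)%N -> #|[set 1 : 'Z_n]%SET| = 2.-1 by rewrite cards1.
have cA2 n : (2 < n)%N -> #|[set -1; 1 : 'Z_n]%SET| = 3.-1.
  move=> n2; rewrite cards2; case: eqVneq => // /eqP.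
  rewrite -subr_eq0 -opprD oppr_eq0 -[X in _ == X](mulr0n 1) -(natrD _ 1 1).
  by rewrite natrZ_eq ?(ltnW n2) // mod0n modn_small.
split; [|split].
- by split; [apply: (whp_sign_Zseq (q := 2))|apply: (whp_not_sign_Zseq (q := 2))].
- by split; [apply: (whp_sign_Zseq (q := 3))|apply: (whp_not_sign_Zseq (q := 3))].
(* The extra 3 guarantees m >= 3, so that the exponent m - 3 is not truncated. *)
apply: whp_of_count => k; have [n0 n0P] := omega_ge (k + 3) homega.
exists n0 => n m /n0P wk n1 m0 [n_odd wm].
have km : (k + 3 <= m)%N by rewrite -(ler_nat R) (le_trans wk).
have := @card_no_unit_zero_sum n m; set B := [set x | _]%SET.
rewrite n1 (leq_trans _ km) ?leq_addl // => /(_ isT isT n_odd) le.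
have k3 : (3 ^ k * 2 ^ m <= 2 ^ k * 3 ^ m)%N.
  by apply: leq_expM_exp => //; apply: leq_trans (leq_addr 3 k) km.
(* The factor m is absorbed as m <= 2^m, which turns m / 3^m into (2/3)^m <= (2/3)^k. *)
have m2 := ltnW (ltn_expl m (isT : 1 < 2)%N).
have m3 : (3 ^ m = 27 * 3 ^ (m - 3))%N.
  by rewrite -[27%N]/(3 ^ 3)%N -expnD subnKC // (leq_trans _ km) ?leq_addl.
rewrite -(leq_pmul2r (expn_gt0 3 m)) {1}m3.
have {}le : (#|B| * 3 ^ (m - 3) <= 2 ^ m * n ^ m)%N.
  by rewrite (leq_trans le) // leq_mul.
apply: (@leq_trans (27 * 3 ^ k * (2 ^ m * n ^ m))).
  by rewrite [leqLHS](_ : _ = 27 * 3 ^ k * (#|B| * 3 ^ (m - 3)))%N; [rewrite leq_mul|ring].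
have {}k3 := leq_mul (leqnn (27 * n ^ m)) k3.
rewrite [leqLHS](_ : _ = 27 * n ^ m * (3 ^ k * 2 ^ m))%N; last by ring.
by rewrite (leq_trans k3) // eq_leq //; ring.
Qed.
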